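(* Let $m=5m'$ with $5\nmid m'$, and assume $11\mid m$. Let $f:\mathbb{Z}_3^3\to\mathbb{Z}_m$ be a function and let $\phi_{m'}:C_m\to C_5$ be the homomorphism defined below, extended linearly to $\mathbb{Z}[C_m]\to\mathbb{Z}[C_5]$. Suppose that for some nonzero $x\in\mathbb{Z}_3^3$ we have $E_x=D_5g^{\alpha_x}+D_{11}(g^{\beta_x}+g^{\gamma_x})$ for some integers $\alpha_x,\beta_x,\gamma_x$. Then $$\phi_{m'}(E_x)=22+D_5=23+u_1+u_1^{-1}+u_2+u_2^{-1}$$ in $\mathbb{Z}[C_5]$, where $u_1,u_2\in C_5$ and on the right $D_5=\sum_{c\in C_5}c$.
   Context: $C_k$ denotes the multiplicative cyclic group of order $k$; $g$ is a fixed generator of $C_m$. For $x\in\mathbb{Z}_3^3$, $E_x=\sum_{y\in\mathbb{Z}_3^3}g^{f(x+y)-f(y)}\in\mathbb{Z}[C_m]$. For $d\mid m$, $D_d=\sum_{h\in H_d}h$ where $H_d$ is the unique subgroup of $C_m$ of order $d$. The map $\phi_{m'}$: write $m=\prod_i p_i^{a_i}$ and $m'=\prod_i p_i^{b_i}$ with $0\le b_i\le a_i$; each element of $C_m$ is uniquely a product $\prod_i g_i$ with $\mathrm{ord}(g_i)$ dividing $p_i^{a_i}$ ($g_i$ in the Sylow $p_i$-subgroup), and $\phi_{m'}(\prod_i g_i)=\prod_i g_i^{p_i^{b_i}}$, a homomorphism $C_m\to C_{m/m'}=C_5$. *)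

(* Defs.v *)
From HB Require Import structures.
From mathcomp Require Import all_boot all_order all_algebra.
From mathcomp Require Import all_fingroup all_solvable.

Set Implicit Arguments.
Unset Strict Implicit.
Unset Printing Implicit Defensive.

Import GRing.Theory.
Local Open Scope ring_scope.

(* The integral group ring Z[G] of a finite group: an element is its family of
   coefficients, and the product is convolution. *)
Definition zgring (gT : finGroupType) := {ffun gT -> int}.

HB.instance Definition _ (gT : finGroupType) :=
  GRing.Zmodule.copy (zgring gT) {ffun gT -> int}.

Section GroupRing.
Variable gT : finGroupType.
Implicit Types a b c : zgring gT.

Definition zg (x : gT) : zgring gT := [ffun y => (y == x)%:R].

Definition zg_mul a b : zgring gT :=
  [ffun x => \sum_(y : gT) a y * b (y^-1 * x)%g].

Fact zg_mulA : associative zg_mul.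
Proof.
move=> a b c; apply/ffunP=> x; rewrite !ffunE.
under eq_bigr => y _ do rewrite ffunE mulr_sumr.
under [RHS]eq_bigr => y _ do rewrite ffunE mulr_suml.
rewrite [RHS]exchange_big /=; apply: eq_bigr => y _.
rewrite [RHS](reindex_inj (mulgI y)) /=; apply: eq_bigr => z _.
by rewrite mulrA mulKg invMg mulgA.
Qed.

Fact zg_mul1 : left_id (zg 1%g) zg_mul.
Proof.
move=> a; apply/ffunP=> x; rewrite ffunE (bigD1 1%g) //= big1 => [|y /negPf nz].
  by rewrite ffunE eqxx mul1r invg1 mul1g addr0.
by rewrite ffunE nz mul0r.
Qed.

Fact zg_mulr1 : right_id (zg 1%g) zg_mul.
Proof.
move=> a; apply/ffunP=> x; rewrite ffunE (bigD1 x) //= big1 => [|y /negPf nz].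
  by rewrite ffunE mulVg eqxx mulr1 addr0.
by rewrite ffunE -eq_mulVg1 nz mulr0.
Qed.

Fact zg_mulDl : left_distributive zg_mul +%R.
Proof.
move=> a b c; apply/ffunP=> x; rewrite !ffunE -big_split /=.
by apply: eq_bigr => y _; rewrite ffunE mulrDl.
Qed.

Fact zg_mulDr : right_distributive zg_mul +%R.
Proof.
move=> a b c; apply/ffunP=> x; rewrite !ffunE -big_split /=.
by apply: eq_bigr => y _; rewrite ffunE mulrDr.
Qed.

Fact zg_nonzero : zg 1%g != 0.
Proof. by apply/eqP=> /ffunP/(_ 1%g); rewrite !ffunE eqxx. Qed.

End GroupRing.

HB.instance Definition _ (gT : finGroupType) :=
  GRing.Zmodule_isNzRing.Build (zgring gT) (@zg_mulA gT) (@zg_mul1 gT)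
    (@zg_mulr1 gT) (@zg_mulDl gT) (@zg_mulDr gT) (@zg_nonzero gT).

Lemma zgM (gT : finGroupType) (x y : gT) : zg (x * y)%g = zg x * zg y.
Proof.
apply/ffunP=> z; rewrite !ffunE (bigD1 x) //= big1 => [|t /negPf nz].
  by rewrite !ffunE eqxx mul1r addr0 (canF_eq (mulKVg x)).
by rewrite ffunE nz mul0r.
Qed.

(* Z-linear extension to Z[G] of a map between groups. *)
Definition zg_map (gT hT : finGroupType) (h : gT -> hT) (a : zgring gT)
  : zgring hT := \sum_(x : gT) zg (h x) *~ a x.

Lemma zg_map_zg (gT hT : finGroupType) (h : gT -> hT) (x : gT) :
  zg_map h (zg x) = zg (h x).
Proof.
rewrite /zg_map (bigD1 x) //= big1 => [|y /negPf nz].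
  by rewrite ffunE eqxx addr0.
by rewrite ffunE nz.
Qed.

Definition expgz (gT : finGroupType) (x : gT) (k : int) : gT :=
  match k with Posz n => (x ^+ n)%g | Negz n => (x ^- n.+1)%g end.

(* The subgroup of order d of the whole group gT; it exists and is unique when
   gT is cyclic and d divides its order (card_subord, subord_uniq). *)
Definition subord (gT : finGroupType) (d : nat) : {group gT} :=
  odflt 1%G [pick H : {group gT} | #|H| == d].

Lemma card_subord (gT : finGroupType) (d : nat) :
  cyclic [set: gT] -> (d %| #|gT|)%N -> #|subord gT d| = d.
Proof.
move=> /cyclicP[g def_g] d_dv; rewrite /subord; case: pickP => [H /eqP //|noH].
have og : #[g]%g = #|gT| by rewrite orderE -def_g cardsT.
have := noH <[g ^+ (#|gT| %/ d)]>%G; rewrite /= -orderE orderXdiv og ?dvdn_div //.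
have gT0 : (0 < #|gT|)%N by rewrite -og order_gt0.
by rewrite divnA // mulKn // eqxx.
Qed.

Lemma subord_uniq (gT : finGroupType) (d : nat) (H : {group gT}) :
  cyclic [set: gT] -> #|H| = d -> subord gT d = H.
Proof.
move=> cyc oH; apply/val_inj/eqP; rewrite /=.
rewrite (eq_subG_cyclic cyc) ?subsetT // card_subord ?oH //.
by rewrite -oH -cardsT cardSg ?subsetT.
Qed.

(* D_d, the sum of the elements of the subgroup of order d. *)
Definition Dsum (gT : finGroupType) (d : nat) : zgring gT :=
  \sum_(h in subord gT d) zg h.

(* The map phi_k: x.`_p is the component of x in the Sylow p-subgroup. *)
Definition phi (gT : finGroupType) (k : nat) (x : gT) : gT :=
  (\prod_(p <- primes #|gT|) x.`_p ^+ (p ^ logn p k))%g.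

Lemma phiM (gT : finGroupType) (k : nat) :
  cyclic [set: gT] -> {morph @phi gT k : x y / (x * y)%g}.
Proof.
move=> /cyclic_abelian/centsP cT x y.
have cc (u v : gT) : commute u v by apply: (cT u (in_setT u) v (in_setT v)).
rewrite /phi; elim: (primes _) => [|p s IHs]; first by rewrite !big_nil mulg1.
rewrite !big_cons IHs consttM // expgMn //.
rewrite -!mulgA; congr (_ * _)%g; rewrite !mulgA; congr (_ * _)%g; exact: cc.
Qed.

Lemma phi_subord (gT : finGroupType) (k : nat) (x : gT) :
  cyclic [set: gT] -> (k %| #|gT|)%N -> phi k x \in subord gT (#|gT| %/ k).
Proof.
move=> cyc k_dv; have gT0 : (0 < #|gT|)%N by rewrite -cardsT cardG_gt0.
have k0 : (0 < k)%N by apply: dvdn_gt0 k_dv.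
rewrite -cycle_subG -(cardSg_cyclic cyc) ?subsetT // card_subord ?dvdn_div //.
rewrite -orderE order_dvdn /phi.
have /centsP cT := cyclic_abelian cyc.
have cc (u v : gT) : commute u v by apply: (cT u (in_setT u) v (in_setT v)).
elim: (primes _) => [|p s IHs]; first by rewrite big_nil expg1n.
rewrite big_cons expgMn // (eqP IHs) mulg1 -expgM -order_dvdn order_constt.
have ox : (#[x]%g %| #|gT|)%N by rewrite -cardsT order_dvdG ?inE.
apply: dvdn_trans (partn_dvd p gT0 ox) _.
have q0 : (0 < #|gT| %/ k)%N by rewrite divn_gt0 // dvdn_leq.
have lm : logn p #|gT| = (logn p k + logn p (#|gT| %/ k))%N.
  by rewrite -lognM // mulnC divnK.
rewrite p_part lm expnD dvdn_mul // -p_part; exact: dvdn_part.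
Qed.

(* phi_k as a map C_m -> C_(m/k), for d = m/k: the cyclic group C_d is the
   subgroup of order d of C_m, which contains the values of phi_k. *)
Definition phi_to (gT : finGroupType) (k d : nat) (x : gT)
  : [subg subord gT d] := subg (subord gT d) (phi k x).

Lemma val_phi_to (gT : finGroupType) (k d : nat) (x : gT) :
  cyclic [set: gT] -> #|gT| = (d * k)%N -> sgval (phi_to k d x) = phi k x.
Proof.
move=> cyc dk; have k0 : (0 < k)%N.
  by move: (cardG_gt0 [set: gT]); rewrite cardsT dk muln_gt0 => /andP[].
rewrite subgK //; have := @phi_subord gT k x cyc.
by rewrite dk mulnK // dvdn_mull //; apply.
Qed.

Section Esum.
Variables (m : nat) (gT : finGroupType) (g : gT).

(* The exponent is the representative in [0, m) of an element of Z_m; it is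
   meant for g of order m > 1 ('Z_m is Z/2 for m = 0, 1). *)
Definition Esum (f : 'rV['Z_3]_3 -> 'Z_m) (x : 'rV['Z_3]_3) : zgring gT :=
  \sum_(y : 'rV['Z_3]_3) zg (g ^+ (f (x + y) - f y)%R)%g.

End Esum.

(* Main.v *)
Require Import Defs.
From HB Require Import structures.
From mathcomp Require Import all_boot all_order all_algebra.
From mathcomp Require Import all_fingroup all_solvable.
Import Order.TTheory GRing.Theory Num.Theory.
Local Open Scope ring_scope.

(** Put [h y = phi (g ^ (f (x + y) - f y))]. Since [x] has order 3, the exponents
    along [y, y + x, y + 2x] telescope, so [h y * h (y + x) * h (y + 2x) = 1].
    Applying [phi] to the hypothesis shows that the 27 values [h y] form the
    multiset [D_5 + 11 b + 11 c] of [C_5]. If [(b, c) <> (1, 1)], there is an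
    integer weight on [C_5] that is nonnegative on each triple of product 1 but
    has negative total on this multiset; averaging over the translations by [x]
    then gives a contradiction. Hence [b = c = 1]. *)

(* The elements of [C_5] are written as residues mod 5. The values were found by
   linear programming duality; in the case [c = 3b] the weight at [k * b] is the
   [k]-th entry of [[:: 2; 1; 0; -2; 4]], and 1/b = b^3 mod 5. *)
Definition triple_weight (b c a : nat) : int :=
  let cyc t := nth 0 [:: 2; 1; 0; -2; 4] (a * t ^ 3 %% 5)%N in
  if (b == 0)%N || (c == 0)%N then
    if a == 0%N then 0 else if a == (b + c)%N then -1 else 2
  else if c == (3 * b %% 5)%N then cyc b
  else if b == (3 * c %% 5)%N then cyc c
  else if (a == b) || (a == c) then -1 else 2.

(** A dual certificate in additive notation: the first conjunct is about the weight of D_5 + 11 b +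
    11 c, the second about the exponents of triples of product 1 in C_5. *)
Definition separates (b c : nat) (w : nat -> int) :=
  (w 0%N + w 1%N + w 2%N + w 3%N + w 4%N + (w b + w c) *+ 11 < 0) &&
  all (fun i => all (fun j => all (fun k =>
    ((i + j + k) %% 5 == 0)%N ==> (0 <= w i + w j + w k))
    (iota 0 5)) (iota 0 5)) (iota 0 5).

Lemma triple_weight_separates (b c : nat) :
  (b < 5)%N -> (c < 5)%N -> (b != 0%N) || (c != 0%N) ->
  separates b c (triple_weight b c).
Proof.
move=> lb lc bc.
have /allP/(_ b) : all (fun b => all (fun c => (b != 0%N) || (c != 0%N) ==>
  separates b c (triple_weight b c)) (iota 0 5)) (iota 0 5) by vm_compute.
by rewrite mem_iota => /(_ lb)/allP/(_ c); rewrite mem_iota bc => /(_ lc).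
Qed.

Section GroupRingFunctional.
Variable gT : finGroupType.

(** The linear form on Z[G] extending [w]; it turns an identity in the group ring into an equation
    between total weights. *)
Definition zg_eval (w : gT -> int) (a : zgring gT) : int := \sum_z a z * w z.

Lemma zg_evalD w : {morph zg_eval w : a b / a + b}.
Proof.
move=> a b; rewrite /zg_eval -big_split /=; apply: eq_bigr => z _.
by rewrite ffunE mulrDl.
Qed.

Lemma zg_eval0 w : zg_eval w 0 = 0.
Proof. by rewrite /zg_eval big1 // => z _; rewrite ffunE mul0r. Qed.

Lemma zg_eval_zg w z : zg_eval w (zg z) = w z.
Proof.
rewrite /zg_eval (bigD1 z) //= big1 => [|y /negPf nz].
  by rewrite ffunE eqxx mul1r addr0.
by rewrite ffunE nz mul0r.
Qed.

Lemma zg_eval_sum w (I : finType) (P : pred I) (F : I -> zgring gT) :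
  zg_eval w (\sum_(i | P i) F i) = \sum_(i | P i) zg_eval w (F i).
Proof. exact: (big_morph _ (zg_evalD w) (zg_eval0 w)). Qed.

Lemma zg_evalMn w a n : zg_eval w (a *+ n) = zg_eval w a *+ n.
Proof.
by elim: n => [|n IHn]; rewrite ?mulr0n ?zg_eval0 // !mulrS zg_evalD IHn.
Qed.

End GroupRingFunctional.

Lemma zg_mapD (gT hT : finGroupType) (h : gT -> hT) :
  {morph zg_map h : a b / a + b}.
Proof.
move=> a b; rewrite /zg_map -big_split /=; apply: eq_bigr => z _.
by rewrite ffunE mulrzDr.
Qed.

Lemma zg_map_sum (gT hT : finGroupType) (h : gT -> hT) (I : finType)
    (P : pred I) (F : I -> zgring gT) :
  zg_map h (\sum_(i | P i) F i) = \sum_(i | P i) zg_map h (F i).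
Proof.
apply: (big_morph _ (zg_mapD _ _ h)); rewrite /zg_map big1 // => z _.
by rewrite ffunE mulr0z.
Qed.

Section OrderFive.
Variables (gT : finGroupType) (oT : #|gT| = 5%N).

Lemma order5_generator : exists2 u : gT, #[u]%g = 5%N & [set: gT] = <[u]>%g.
Proof.
have /cyclicP[u def_u] : cyclic [set: gT] by rewrite prime_cyclic // cardsT oT.
by exists u; rewrite // orderE -def_u cardsT.
Qed.

(** The discrete logarithm [e] to the base [u] carries weights on residues mod 5 over to the
    group. *)
Lemma order5_log : exists2 u : gT, #[u]%g = 5%N &
  exists2 e : gT -> nat, (forall z, (e z < 5)%N) & (forall z, (u ^+ e z)%g = z).
Proof.
have [u ou def_u] := order5_generator; exists u => //.
have ex (z : gT) : exists k : 'I_5, (u ^+ k)%g == z.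
  have /cyclePmin[k lk ->] : z \in <[u]>%g by rewrite -def_u inE.
  by rewrite ou in lk; exists (Ordinal lk).
exists (fun z => nat_of_ord (xchoose (ex z))) => z; first exact: ltn_ord.
exact: eqP (xchooseP (ex z)).
Qed.

Lemma order5_big (R : zmodType) (u : gT) (F : gT -> R) : #[u]%g = 5%N ->
  \sum_z F z
    = F 1%g + F u + F (u ^+ 2)%g + F (u ^+ 3)%g + F (u ^+ 4)%g.
Proof.
move=> ou; pose p (k : 'I_5) := (u ^+ k)%g.
have p_inj : injective p.
  move=> i j /eqP; rewrite /p eq_expg_mod_order ou !modn_small // => /eqP.
  exact: val_inj.
have p_bij : bijective p by apply: inj_card_bij; rewrite // oT card_ord.
rewrite (reindex p); last exact: onW_bij.
by rewrite !big_ord_recr big_ord0 /= add0r /p /= expg0 expg1.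
Qed.

(** Of the translation by [x] only the relation s^3 = 1 is kept; [b] and [c] carry the surplus
    multiplicity 11. *)
Lemma heavy_points_trivial (X : finType) (s : X -> X) (h : X -> gT) (b c : gT) :
    (forall y, s (s (s y)) = y) ->
    (forall y, h y * h (s y) * h (s (s y)) = 1)%g ->
    \sum_y zg (h y) = \sum_z zg z + (zg b + zg c) *+ 11 ->
  b = 1%g /\ c = 1%g.
Proof.
move=> s3 h3 Eh; have [u ou [e le ue]] := order5_log.
have e_exp k : (k < 5)%N -> e (u ^+ k)%g = k.
  move=> lk; have /eqP := ue (u ^+ k)%g.
  by rewrite eq_expg_mod_order ou !modn_small ?le // => /eqP.
case: (boolP ((e b != 0%N) || (e c != 0%N))) => [nz|]; last first.
  rewrite negb_or !negbK => /andP[/eqP eb /eqP ec].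
  by rewrite -(ue b) -(ue c) eb ec.
have /andP[neg /allP pos] := triple_weight_separates _ _ (le b) (le c) nz.
set w := triple_weight _ _ in neg pos.
have s_inj : injective s by move=> y z eq_s; rewrite -(s3 y) eq_s s3.
have w3 y : 0 <= w (e (h y)) + w (e (h (s y))) + w (e (h (s (s y)))).
  have ie k : e (h k) \in iota 0 5 by rewrite mem_iota le.
  have /allP/(_ _ (ie (s y)))/allP/(_ _ (ie (s (s y))))/implyP := pos _ (ie y).
  (* Since [u] has order 5, product 1 means that the three logarithms sum to 0 mod 5. *)
  by apply; rewrite -/(dvdn _ _) -ou order_dvdn !expgD !ue h3.
have tot : \sum_y w (e (h y)) < 0.
  (* Weighing both sides of [Eh] gives exactly the quantity that [neg] makes negative. *)
  have := congr1 (zg_eval _ (w \o e)) Eh.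
  rewrite zg_evalD zg_evalMn zg_evalD !zg_eval_zg !zg_eval_sum.
  under eq_bigr => y _ do rewrite zg_eval_zg.
  under [X in _ = X + _]eq_bigr => y _ do rewrite zg_eval_zg.
  rewrite (order5_big _ u) //= => ->.
  (* Here [1] and [u] are matched as [u ^+ 0] and [u ^+ 1]. *)
  by rewrite (e_exp 0%N isT) (e_exp 1%N isT) !e_exp.
have : 0 <= (\sum_y w (e (h y))) *+ 3.
  (* As [s] is a permutation, each point occurs once in each of the three positions. *)
  rewrite (_ : _ *+ 3 = \sum_y (w (e (h y)) + w (e (h (s y))) + w (e (h (s (s y)))))).
    by apply: sumr_ge0 => y _; apply: w3.
  rewrite !big_split /= !mulrS mulr0n addr0 addrA.
  by congr (_ + _ + _); rewrite [LHS](reindex_inj s_inj) // [LHS](reindex_inj s_inj).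
by rewrite pmulrn_lge0 // leNgt tot.
Qed.

End OrderFive.

(** Exponents are representatives in [0, m), so the sum in ['Z_m] may wrap around; [g ^+ m = 1]
    absorbs this. *)
Lemma expg_Zp_add (gT : finGroupType) (g : gT) (m : nat) (a b : 'Z_m) :
  (1 < m)%N -> #[g]%g = m -> (g ^+ (a + b)%R = g ^+ a * g ^+ b)%g.
Proof.
move=> m_gt1 og; rewrite -expgD /=.
by apply/eqP; rewrite eq_expg_mod_order og [X in (_ %% X)%N == _ %[mod _]](Zp_cast m_gt1) modn_mod.
Qed.

Lemma constt_prime_group (gT : finGroupType) (G : {group gT}) (p q : nat) (h : gT) :
  prime p -> #|G| = p -> h \in G -> (h.`_q = if q == p then h else 1)%g.
Proof.
move=> p_pr oG Gh; have p_h : (p.-elt h)%g.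
  by rewrite (mem_p_elt _ Gh) // /pgroup oG pnat_id.
case: eqP => [->|/eqP nqp]; first exact: constt_p_elt.
by apply/constt1P; apply: sub_in_pnat p_h => r _ /eqnP ->; rewrite !inE eq_sym.
Qed.

(** In a subgroup of order [p] only the p-component can be nontrivial, and [phi] raises it to the
    power p^0 = 1, as [p] does not divide [k]. *)
Lemma phi_fixed (gT : finGroupType) (k p : nat) (h : gT) :
    cyclic [set: gT] -> prime p -> (p %| #|gT|)%N -> ~~ (p %| k)%N ->
  h \in subord gT p -> phi k h = h.
Proof.
move=> cyc p_pr p_dv npk Hh; rewrite /phi.
rewrite (eq_bigr (fun q => if q == p then h else 1%g)); last first.
  move=> q _; rewrite (constt_prime_group _ _ p q h _ (card_subord cyc p_dv)) //.
  by case: eqP => [->|_]; rewrite ?expg1n // lognE (negPf npk) andbF andbF expn0 expg1.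
rewrite -big_mkcond -big_filter filter_pred1_uniq ?primes_uniq ?big_seq1 //.
by rewrite mem_primes p_pr p_dv -cardsT cardG_gt0.
Qed.

Theorem lemma3p5 (m m' : nat) (gT : finGroupType) (g : gT)
    (f : 'rV['Z_3]_3 -> 'Z_m) (x : 'rV['Z_3]_3) (alpha beta gamma : int)
    (gT_order : #|gT| = m) (g_gen : generator [set: gT] g)
    (m_eq : m = (5 * m')%N) (m'_5 : ~~ (5 %| m')%N) (m_11 : (11 %| m)%N)
    (x_neq0 : x != 0)
    (E_eq : Esum g f x = Dsum gT 5 * zg (expgz g alpha)
              + Dsum gT 11 * (zg (expgz g beta) + zg (expgz g gamma))) :
  let C5 := [subg subord gT 5] in
  let D5 : zgring C5 := \sum_(c : C5) zg c in
  zg_map (phi_to m' 5) (Esum g f x) = 22%:R + D5 /\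
  exists u1 u2 : C5,
    22%:R + D5 = 23%:R + zg u1 + zg u1^-1%g + zg u2 + zg u2^-1%g.
Proof.
move=> C5 D5.
have def_g : [set: gT] = <[g]>%g by apply/eqP.
have og : #[g]%g = m by rewrite orderE -def_g cardsT.
have cyc : cyclic [set: gT] by apply/cyclicP; exists g.
have m_gt1 : (1 < m)%N.
  have : (0 < m)%N by rewrite -og order_gt0.
  by rewrite m_eq muln_gt0 /= => m'0; rewrite (leq_trans _ (leq_pmulr 5 m'0)).
have dv5 : (5 %| #|gT|)%N by rewrite gT_order m_eq dvdn_mulr.
have dv11 : (11 %| #|gT|)%N by rewrite gT_order.
have o5 := card_subord cyc dv5; have o11 := card_subord cyc dv11.
have oC5 : #|C5| = 5%N by rewrite card_sub.
pose psi : gT -> C5 := @phi_to gT m' 5.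
have val_psi y : sgval (psi y) = phi m' y by apply: val_phi_to; rewrite ?gT_order.
have psiM : {morph psi : y z / (y * z)%g}.
  by move=> y z; apply: val_inj; rewrite /= !val_psi phiM.
have psi1 : psi 1%g = 1%g by apply: (mulgI (psi 1%g)); rewrite -psiM !mulg1.
have psiX k y : psi (y ^+ k)%g = (psi y ^+ k)%g.
  by elim: k => [|k IHk]; rewrite ?expg0 // !expgS psiM IHk.
have psi5 h : h \in subord gT 5 -> psi h = subg (subord gT 5) h.
  by move=> Hh; apply: val_inj; rewrite /= val_psi (phi_fixed _ _ 5%N) // subgK.
have psi11 h : h \in subord gT 11 -> psi h = 1%g.
  (* The order of [psi h] divides both 5 and 11. *)
  move=> Hh; have dv5h : (#[psi h]%g %| 5)%N.
    by have := order_dvdG (in_setT (psi h)); rewrite cardsT oC5.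
  have h11 : (h ^+ 11 = 1)%g by have := expg_cardG Hh; rewrite o11.
  have : (#[psi h]%g %| gcdn 5 11)%N.
    by rewrite dvdn_gcd dv5h order_dvdn -psiX h11 psi1 eqxx.
  by rewrite -[gcdn 5 11]/1%N dvdn1 order_eq1 => /eqP.
have map5 z : zg_map psi (Dsum gT 5 * zg z) = D5.
  rewrite /Dsum mulr_suml zg_map_sum.
  under eq_bigr => h Hh do rewrite -zgM zg_map_zg psiM psi5 //.
  (* Multiplication by [psi z] permutes C_5, which absorbs the factor [z]; then C_5 is identified
     with the subgroup of order 5. *)
  rewrite /D5 (reindex_inj (mulIg (psi z))) /=.
  rewrite [RHS](reindex_onto (subg (subord gT 5)) sgval) /=; last by move=> c _; apply: sgvalK.
  apply: eq_bigl => h; apply/idP/eqP => [Hh|<-]; [exact: subgK | exact: subgP].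
have map11 z : zg_map psi (Dsum gT 11 * zg z) = zg (psi z) *+ 11.
  rewrite /Dsum mulr_suml zg_map_sum.
  under eq_bigr => h Hh do rewrite -zgM zg_map_zg psiM psi11 // mul1g.
  by rewrite sumr_const o11.
set b := psi (expgz g beta); set c := psi (expgz g gamma).
have psiE : zg_map psi (Esum g f x) = D5 + (zg b + zg c) *+ 11.
  by rewrite E_eq mulrDr !zg_mapD map5 !map11 mulrnDl.
pose h y := psi (g ^+ (f (x + y) - f y)%R)%g.
have Eh : zg_map psi (Esum g f x) = \sum_y zg (h y).
  by rewrite /Esum zg_map_sum; apply: eq_bigr => y _; rewrite zg_map_zg.
have x3 y : x + (x + (x + y)) = y.
  rewrite !addrA -[RHS]add0r; congr (_ + _); apply/rowP => i.
  by rewrite !mxE; apply: val_inj; case: (x _ i) => [[|[|[|]]]].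
have h3 y : (h y * h (x + y)%R * h (x + (x + y))%R = 1)%g.
  rewrite /h -!psiM -!expg_Zp_add // x3.
  (* After [x3] the exponent is a closed cycle of differences of values of [f]. *)
  rewrite [X in (_ ^+ nat_of_ord X)%g](_ : _ = 0) ?expg0 //.
  by rewrite [X in X + _]addrC !subrKA subrr.
have [b1 c1] : b = 1%g /\ c = 1%g.
  by apply: (heavy_points_trivial C5 oC5 _ _ h _ _ x3 h3); rewrite -Eh.
split.
  (* The surplus is now 11 (1 + 1) = 22 times the unit. *)
  by rewrite -/psi psiE b1 c1 addrC -mulr2n -mulrnA.
have [u ou _] := order5_generator C5 oC5.
(* C_5 consists of 1, u, u^-1, u^2 and u^-2; the term 1 raises 22 to 23. *)
exists u, (u ^+ 2)%g.
have u5 : (u ^+ 5 = 1)%g by have := expg_order u; rewrite ou.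
have inv k l : (k + l = 5)%N -> ((u ^+ k)^-1 = u ^+ l)%g.
  by move=> kl; apply/eqP; rewrite eq_invg_mul -expgD kl u5.
have u4 : (u^-1 = u ^+ 4)%g := inv 1%N 4 erefl.
rewrite /D5 (order5_big C5 oC5 _ u) // u4 (inv 2 3)%N //.
rewrite [23%:R]mulrSr -[1]/(zg 1%g); move: (22%:R) => n.
by rewrite -!addrA; do 3 congr (_ + _); rewrite addrA addrC.
Qed.
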